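(* Let $H$ be a Hopf algebra over a field $k$ with antipode $S$, and let $A$ be a finite dimensional right $H$-comodule algebra. The following assertions are equivalent. (1) $A$ is right $H$-Frobenius. (2) There exists a non-degenerate associative bilinear form $B:A\times A\to k$ such that $B(h^*\cdot a,b)=B(a,(h^*S)\cdot b)$ for any $a,b\in A$ and any $h^*\in H^*$. (3) $A$ has a hyperplane $\mathcal{H}$ which does not contain any non-zero right ideal of $A$, and $h^*\cdot A\subseteq\mathcal{H}$ for any $h^*\in H^*$ with $h^*(1)=0$. (4) $A$ has a hyperplane $\mathcal{H}$ which does not contain any non-zero subobject of $A$ in $\mathcal{M}^H_A$, and $h^*\cdot A\subseteq\mathcal{H}$ for any $h^*\in H^*$ with $h^*(1)=0$. (5) $A$ is a Frobenius algebra in the monoidal category $\mathcal{M}^H$.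
   Context: All algebras and coalgebras are over the field $k$; the antipode $S$ is not assumed bijective. $\mathcal{M}^H$ is the monoidal category of right $H$-comodules. A right $H$-comodule algebra is an algebra in $\mathcal{M}^H$, with coaction $a\mapsto\sum a_0\otimes a_1$ that is an algebra map $A\to A\otimes H$. The associated left action of $H^*=\mathrm{Hom}(H,k)$ on $A$ is $h^*\cdot a=\sum h^*(a_1)a_0$; $h^*S$ denotes the composition $h^*\circ S$. A hyperplane is a linear subspace of codimension 1. A bilinear form $B$ is associative if $B(xy,z)=B(x,yz)$ for all $x,y,z\in A$. $\mathcal{M}^H_A$ is the category of right $(A,H)$-Doi-Hopf modules: right $A$-modules $M$ that are right $H$-comodules with $\rho(ma)=\sum m_0a_0\otimes m_1a_1$; morphisms are $A$-linear $H$-colinear maps. $A$ itself is an object of $\mathcal{M}^H_A$. The dual space $A^*$ is a right $H$-comodule with coaction $f\mapsto\sum f_{0}\otimes f_{1}$ determined by $\sum f_{0}(x)f_{1}=\sum f(x_0)S(x_1)$ for all $x\in A$. Together with the right action $(fa)(x)=f(ax)$, $A^*$ is an object of $\mathcal{M}^H_A$. $A$ is called right $H$-Frobenius if $A\simeq A^*$ in $\mathcal{M}^H_A$. An algebra $R$ in $\mathcal{M}^H$ is a Frobenius algebra in $\mathcal{M}^H$ if there is a coalgebra structure $(R,\delta,\varepsilon_R)$ in $\mathcal{M}^H$ (i.e. $\delta:R\to R\otimes R$ and $\varepsilon_R:R\to k$ are $H$-colinear, coassociative and counital) such that $\delta$ is a morphism of $R,R$-bimodules. *)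

(* Defs.v *)
From HB Require Import structures.
From mathcomp Require Import all_boot all_order all_algebra all_field.
From mathcomp Require Import boolp.

Set Implicit Arguments.
Unset Strict Implicit.
Unset Printing Implicit Defensive.
Import GRing.Theory.
Local Open Scope ring_scope.
Local Open Scope quotient_scope.

Reserved Notation "U ⊗ V" (at level 40, left associativity).
Reserved Notation "u \ox v" (at level 40, left associativity).

(* The tensor product of two vector spaces of arbitrary dimension: formal sums
   of pairs, two of them being identified when every bilinear map to every
   vector space takes the same value on both.  [tens_ind], [tliftE] and
   [tlift_unique] give generation by pure tensors and the universal property. *)
Section TensorProduct.
Variables (k : fieldType) (U V : lmodType k).

Definition formal_eval (W : lmodType k) (b : U -> V -> W) (s : seq (U * V)) : W :=
  \sum_(p <- s) b p.1 p.2.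

Definition tens_equiv (s t : seq (U * V)) : bool :=
  `[< forall (W : lmodType k) (b : {bilinear U -> V -> W}),
        formal_eval b s = formal_eval b t >].

Lemma tens_equivP s t :
  reflect (forall (W : lmodType k) (b : {bilinear U -> V -> W}),
             formal_eval b s = formal_eval b t) (tens_equiv s t).
Proof. exact: asboolP. Qed.

Lemma tens_equiv_is_equiv : equiv_class_of tens_equiv.
Proof.
split=> [s|s t|t s u].
- exact/tens_equivP.
- by apply/tens_equivP/tens_equivP => h W b; rewrite h.
- by move=> /tens_equivP h1 /tens_equivP h2; apply/tens_equivP => W b; rewrite h1 h2.
Qed.

Canonical tens_equiv_equiv := EquivRelPack tens_equiv_is_equiv.
Canonical tens_equiv_encModRel := defaultEncModRel tens_equiv.

Definition tensor := {eq_quot tens_equiv}.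
HB.instance Definition _ : EqQuotient _ tens_equiv tensor := EqQuotient.on tensor.
HB.instance Definition _ := Choice.on tensor.

Lemma tensor_eqP s t :
  reflect (forall (W : lmodType k) (b : {bilinear U -> V -> W}),
             formal_eval b s = formal_eval b t) (\pi_tensor s == \pi_tensor t).
Proof. by rewrite [_ == _](eqmodE tens_equiv_equiv); apply: tens_equivP. Qed.

Lemma formal_eval_repr (W : lmodType k) (b : {bilinear U -> V -> W}) s :
  formal_eval b (repr (\pi_tensor s)) = formal_eval b s.
Proof. by have /eqP/tensor_eqP -> := reprK (\pi_tensor s). Qed.

Definition tzero : tensor := \pi_tensor [::].
Definition tadd (x y : tensor) : tensor := \pi_tensor (repr x ++ repr y).
Definition tscale (a : k) (x : tensor) : tensor :=
  \pi_tensor [seq (a *: p.1, p.2) | p <- repr x].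
Definition topp (x : tensor) : tensor := tscale (-1) x.

Lemma formal_eval_cat (W : lmodType k) (b : U -> V -> W) s t :
  formal_eval b (s ++ t) = formal_eval b s + formal_eval b t.
Proof. by rewrite /formal_eval big_cat. Qed.

Lemma formal_eval_scale (W : lmodType k) (b : {bilinear U -> V -> W}) a s :
  formal_eval b [seq (a *: p.1, p.2) | p <- s] = a *: formal_eval b s.
Proof.
rewrite /formal_eval big_map scaler_sumr; apply: eq_bigr => p _ /=.
by rewrite linearZl_LR.
Qed.

Lemma tensor_ext (x y : tensor) :
  (forall (W : lmodType k) (b : {bilinear U -> V -> W}),
     formal_eval b (repr x) = formal_eval b (repr y)) -> x = y.
Proof. by move=> h; rewrite -[x]reprK -[y]reprK; apply/eqP/tensor_eqP. Qed.

Lemma evalD (W : lmodType k) (b : {bilinear U -> V -> W}) x y :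
  formal_eval b (repr (tadd x y)) = formal_eval b (repr x) + formal_eval b (repr y).
Proof. by rewrite formal_eval_repr formal_eval_cat. Qed.

Lemma evalZ (W : lmodType k) (b : {bilinear U -> V -> W}) a x :
  formal_eval b (repr (tscale a x)) = a *: formal_eval b (repr x).
Proof. by rewrite formal_eval_repr formal_eval_scale. Qed.

Lemma eval0 (W : lmodType k) (b : {bilinear U -> V -> W}) : formal_eval b (repr tzero) = 0.
Proof. by rewrite formal_eval_repr /formal_eval big_nil. Qed.

Fact taddA : associative tadd.
Proof. by move=> x y z; apply: tensor_ext => W b; rewrite !evalD addrA. Qed.
Fact taddC : commutative tadd.
Proof. by move=> x y; apply: tensor_ext => W b; rewrite !evalD addrC. Qed.
Fact tadd0 : left_id tzero tadd.
Proof. by move=> x; apply: tensor_ext => W b; rewrite evalD eval0 add0r. Qed.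
Fact taddN : left_inverse tzero topp tadd.
Proof.
by move=> x; apply: tensor_ext => W b; rewrite evalD evalZ eval0 scaleN1r addNr.
Qed.

HB.instance Definition _ := GRing.isZmodule.Build tensor taddA taddC tadd0 taddN.

Fact tscaleA a b x : tscale a (tscale b x) = tscale (a * b) x.
Proof. by apply: tensor_ext => W c; rewrite !evalZ scalerA. Qed.
Fact tscale1 : left_id 1 tscale.
Proof. by move=> x; apply: tensor_ext => W c; rewrite evalZ scale1r. Qed.
Fact tscaleDr : right_distributive tscale +%R.
Proof.
by move=> a x y; apply: tensor_ext => W c; rewrite evalZ !evalD !evalZ scalerDr.
Qed.
Fact tscaleDl x : {morph tscale^~ x : a b / a + b}.
Proof. by move=> a b; apply: tensor_ext => W c; rewrite evalD !evalZ scalerDl. Qed.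

HB.instance Definition _ :=
  GRing.Zmodule_isLmodule.Build k tensor tscaleA tscale1 tscaleDr tscaleDl.

Definition tens (u : U) (v : V) : tensor := \pi_tensor [:: (u, v)].

Lemma eval_tens (W : lmodType k) (b : {bilinear U -> V -> W}) u v :
  formal_eval b (repr (tens u v)) = b u v.
Proof. by rewrite formal_eval_repr /formal_eval big_seq1. Qed.

Fact tens_is_bilinear : bilinear_for *:%R *:%R tens.
Proof.
split=> [v a u u'|u a v v']; apply: tensor_ext => W b;
  rewrite evalD evalZ !eval_tens.
- exact: linearPl.
- exact: linearPr.
Qed.

HB.instance Definition _ :=
  bilinear_isBilinear.Build k U V tensor _ _ tens tens_is_bilinear.

(* Locked so that unification does not expose the representative. *)
Definition tlift (W : lmodType k) (b : {bilinear U -> V -> W}) (x : tensor) : W :=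
  locked (formal_eval b (repr x)).

Fact tlift_is_linear (W : lmodType k) (b : {bilinear U -> V -> W}) : linear (tlift b).
Proof. by move=> a x y; rewrite /tlift -!lock evalD evalZ. Qed.

HB.instance Definition _ (W : lmodType k) (b : {bilinear U -> V -> W}) :=
  GRing.isLinear.Build k tensor W _ (tlift b) (tlift_is_linear b).

Lemma tliftE (W : lmodType k) (b : {bilinear U -> V -> W}) u v : tlift b (tens u v) = b u v.
Proof. by rewrite /tlift -lock eval_tens. Qed.

Lemma tlift_lin (W : lmodType k) (b b1 b2 : {bilinear U -> V -> W}) (a : k) :
  (forall u v, b u v = a *: b1 u v + b2 u v) ->
  forall x, tlift b x = a *: tlift b1 x + tlift b2 x.
Proof.
move=> h x; rewrite /tlift -!lock /formal_eval scaler_sumr -big_split /=.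
by apply: eq_bigr => p _; rewrite h.
Qed.

Lemma tens_sum (x : tensor) : exists s : seq (U * V), x = \sum_(p <- s) tens p.1 p.2.
Proof.
exists (repr x); rewrite -[LHS]reprK; elim: (repr x) => [|[u v] s IH].
  by rewrite big_nil.
rewrite big_cons /= -IH; apply: tensor_ext => W b.
rewrite evalD eval_tens !formal_eval_repr /formal_eval big_cons //.
Qed.

Lemma tens_ind (P : tensor -> Prop) :
  P 0 -> (forall u v x, P x -> P (tens u v + x)) -> forall x, P x.
Proof.
move=> P0 PD x; have [s ->] := tens_sum x; elim: s => [|p s IH].
  by rewrite big_nil.
by rewrite big_cons; apply: PD.
Qed.

Lemma tlift_unique (W : lmodType k) (f g : {linear tensor -> W}) :
  (forall u v, f (tens u v) = g (tens u v)) -> f =1 g.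
Proof.
move=> h; elim/tens_ind => [|u v x IH]; first by rewrite !linear0.
by rewrite !linearD h IH.
Qed.

End TensorProduct.

Notation "U ⊗ V" := (tensor U V) : type_scope.
Notation "U ⊗ V" := (tensor U V) : ring_scope.
Notation "u \ox v" := (tens u v) : ring_scope.

Section TensorMaps.
Variable k : fieldType.
Implicit Types U V W X Y : lmodType k.

Lemma bilinearI U V W (f : U -> V -> W) :
  (forall v a u u', f (a *: u + u') v = a *: f u v + f u' v) ->
  (forall u a v v', f u (a *: v + v') = a *: f u v + f u v') ->
  bilinear_for *:%R *:%R f.
Proof. by []. Qed.

Section Map.
Variables (U V X Y : lmodType k) (f : {linear U -> X}) (g : {linear V -> Y}).

Definition tmap_fun (u : U) (v : V) : X ⊗ Y := f u \ox g v.

Fact tmap_fun_is_bilinear : bilinear_for *:%R *:%R tmap_fun.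
Proof.
apply: bilinearI => [v a u u'|u a v v']; rewrite /tmap_fun linearP.
- exact: linearPl.
- exact: linearPr.
Qed.

HB.instance Definition _ :=
  bilinear_isBilinear.Build k U V _ _ _ tmap_fun tmap_fun_is_bilinear.

Definition tmap : {linear U ⊗ V -> X ⊗ Y} := tlift tmap_fun.

Lemma tmapE u v : tmap (u \ox v) = f u \ox g v.
Proof. exact: tliftE. Qed.

End Map.

Lemma eq_tmap U V X Y (f f' : {linear U -> X}) (g g' : {linear V -> Y}) :
  f =1 f' -> g =1 g' -> tmap f g =1 tmap f' g'.
Proof. by move=> ff gg; apply: tlift_unique => u v; rewrite !tmapE ff gg. Qed.

Section Assoc.
Variables U V W : lmodType k.

Definition tassoc_fun (w : W) (u : U) (v : V) : U ⊗ (V ⊗ W) := u \ox (v \ox w).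

Fact tassoc_fun_is_bilinear w : bilinear_for *:%R *:%R (tassoc_fun w).
Proof.
apply: bilinearI => [v a u u'|u a v v']; rewrite /tassoc_fun.
- exact: linearPl.
- by rewrite linearPl linearPr.
Qed.

HB.instance Definition _ w :=
  bilinear_isBilinear.Build k U V _ _ _ (tassoc_fun w) (tassoc_fun_is_bilinear w).

Definition tassoc_lift (x : U ⊗ V) (w : W) : U ⊗ (V ⊗ W) := tlift (tassoc_fun w) x.

Fact tassoc_lift_is_bilinear : bilinear_for *:%R *:%R tassoc_lift.
Proof.
apply: bilinearI => [w a x y|x a w w']; rewrite /tassoc_lift ?linearP //.
by apply: tlift_lin => u v; rewrite /= /tassoc_fun !linearPr.
Qed.

HB.instance Definition _ :=
  bilinear_isBilinear.Build k (tensor U V) W _ _ _ tassoc_lift tassoc_lift_is_bilinear.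

Definition tassoc : {linear U ⊗ V ⊗ W -> U ⊗ (V ⊗ W)} := tlift tassoc_lift.

Lemma tassocE u v w : tassoc (u \ox v \ox w) = u \ox (v \ox w).
Proof. by rewrite /= tliftE /= /tassoc_lift tliftE. Qed.

End Assoc.

Section Units.
Variable V : lmodType k.

Definition tunitr_fun (v : V) (c : k^o) : V := (c : k) *: v.
Definition tunitl_fun (c : k^o) (v : V) : V := (c : k) *: v.

Fact tunitr_fun_is_bilinear : bilinear_for *:%R *:%R tunitr_fun.
Proof.
apply: bilinearI => [c a u v|v a c d]; rewrite /tunitr_fun.
- by rewrite scalerDr !scalerA mulrC.
- by rewrite scalerDl scalerA.
Qed.

Fact tunitl_fun_is_bilinear : bilinear_for *:%R *:%R tunitl_fun.
Proof. by case: tunitr_fun_is_bilinear. Qed.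

HB.instance Definition _ :=
  bilinear_isBilinear.Build k V k^o V _ _ tunitr_fun tunitr_fun_is_bilinear.
HB.instance Definition _ :=
  bilinear_isBilinear.Build k k^o V V _ _ tunitl_fun tunitl_fun_is_bilinear.

Definition tunitr : {linear V ⊗ k^o -> V} := tlift tunitr_fun.
Definition tunitl : {linear k^o ⊗ V -> V} := tlift tunitl_fun.

Lemma tunitrE v c : tunitr (v \ox c) = (c : k) *: v.
Proof. exact: tliftE. Qed.
Lemma tunitlE v c : tunitl (c \ox v) = (c : k) *: v.
Proof. exact: tliftE. Qed.

End Units.

Section Map2.
Variables U V U' V' X Y : lmodType k.
Variables (F : {bilinear U -> U' -> X}) (G : {bilinear V -> V' -> Y}).

Definition tmap2_fun (y : U' ⊗ V') (u : U) (v : V) : X ⊗ Y := tmap (F u) (G v) y.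

Fact tmap2_fun_is_bilinear y : bilinear_for *:%R *:%R (tmap2_fun y).
Proof.
apply: bilinearI => [v a u u'|u a v v']; rewrite /tmap2_fun;
  apply: tlift_lin => p q; rewrite /= /tmap_fun /=.
- by rewrite (linearPl F) (linearPl (@tens k X Y)).
- by rewrite (linearPl G) (linearPr (@tens k X Y)).
Qed.

HB.instance Definition _ y :=
  bilinear_isBilinear.Build k U V _ _ _ (tmap2_fun y) (tmap2_fun_is_bilinear y).

(* (u \ox v, u' \ox v') |-> F u u' \ox G v v' *)
Definition tmap2 (x : U ⊗ V) (y : U' ⊗ V') : X ⊗ Y := tlift (tmap2_fun y) x.

Fact tmap2_is_bilinear : bilinear_for *:%R *:%R tmap2.
Proof.
apply: bilinearI => [y a x x'|x a y y']; rewrite /tmap2 ?linearP //.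
by apply: tlift_lin => u v; rewrite /= /tmap2_fun linearP.
Qed.

HB.instance Definition _ :=
  bilinear_isBilinear.Build k (tensor U V) (tensor U' V') _ _ _ tmap2 tmap2_is_bilinear.

Lemma tmap2E u v u' v' : tmap2 (u \ox v) (u' \ox v') = F u u' \ox G v v'.
Proof. by rewrite /tmap2 tliftE; apply: tmapE. Qed.

End Map2.

Section Algebra.
Variable A : algType k.

Definition amul (a b : A) : A := a * b.

Fact amul_is_bilinear : bilinear_for *:%R *:%R amul.
Proof.
apply: bilinearI => [b c a a'|a c b b']; rewrite /amul.
- by rewrite mulrDl scalerAl.
- by rewrite mulrDr scalerAr.
Qed.

HB.instance Definition _ :=
  bilinear_isBilinear.Build k A A A _ _ amul amul_is_bilinear.

End Algebra.

Definition tmul (A B : algType k) : A ⊗ B -> A ⊗ B -> A ⊗ B :=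
  tmap2 (@amul A) (@amul B).

End TensorMaps.

Arguments tassoc {k U V W}.
Arguments tunitr {k V}.
Arguments tunitl {k V}.

Definition is_coalgebra (k : fieldType) (C : lmodType k)
    (delta : {linear C -> C ⊗ C}) (eps : {linear C -> k^o}) : Prop :=
  [/\ forall c, tassoc (tmap delta idfun (delta c)) = tmap idfun delta (delta c),
      forall c, tunitl (tmap eps idfun (delta c)) = c
    & forall c, tunitr (tmap idfun eps (delta c)) = c].

HB.mixin Record isHopfAlgebra (k : fieldType) H of GRing.Algebra k H := {
  comul : {linear H -> H ⊗ H};
  counit : {linear H -> k^o};
  antipode : {linear H -> H};
  comul_coalgebra : is_coalgebra comul counit;
  comulM : forall x y : H, comul (x * y) = tmul (comul x) (comul y);
  comul1 : comul 1 = 1 \ox 1;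
  counitM : forall x y : H, (counit (x * y) : k) = counit x * counit y;
  counit1 : counit 1 = 1 :> k;
  antipodel : forall x : H,
    tlift (@amul k H) (tmap antipode idfun (comul x)) = (counit x : k)%:A;
  antipoder : forall x : H,
    tlift (@amul k H) (tmap idfun antipode (comul x)) = (counit x : k)%:A
}.

#[short(type="hopfAlgType")]
HB.structure Definition HopfAlgebra (k : fieldType) :=
  {H of isHopfAlgebra k H & GRing.Algebra k H}.

Section Comodules.
Variables (k : fieldType) (H : hopfAlgType k).

Definition is_comodule (V : lmodType k) (rho : {linear V -> V ⊗ H}) : Prop :=
  (forall v, tassoc (tmap rho idfun (rho v)) = tmap idfun (@comul k H) (rho v)) /\
  (forall v, tunitr (tmap idfun (@counit k H) (rho v)) = v).

Definition colinear (V W : lmodType k) (rhoV : {linear V -> V ⊗ H})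
    (rhoW : {linear W -> W ⊗ H}) (f : {linear V -> W}) : Prop :=
  forall v, rhoW (f v) = tmap f idfun (rhoV v).

Definition triv_coact : {linear k^o -> k^o ⊗ H} := applyr (@tens k k^o H) 1.

(* v \ox w |-> v_0 \ox w_0 \ox v_1 w_1 *)
Section TensorCoaction.
Variables (V W : lmodType k).
Variables (rhoV : {linear V -> V ⊗ H}) (rhoW : {linear W -> W ⊗ H}).

Definition tens_coact_fun (v : V) (w : W) : V ⊗ W ⊗ H :=
  tmap2 (@tens k V W) (@amul k H) (rhoV v) (rhoW w).

Fact tens_coact_fun_is_bilinear : bilinear_for *:%R *:%R tens_coact_fun.
Proof.
apply: bilinearI => [w a v v'|v a w w']; rewrite /tens_coact_fun linearP.
- exact: linearPl.
- exact: linearPr.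
Qed.

HB.instance Definition _ :=
  bilinear_isBilinear.Build k V W _ _ _ tens_coact_fun tens_coact_fun_is_bilinear.

Definition tens_coact : {linear V ⊗ W -> V ⊗ W ⊗ H} := tlift tens_coact_fun.

End TensorCoaction.
End Comodules.

HB.mixin Record isComoduleAlgebra (k : fieldType) (H : hopfAlgType k) A
    of Falgebra k A := {
  coact : {linear A -> A ⊗ H};
  coact_comodule : is_comodule coact;
  coactM : forall a b : A, coact (a * b) = tmul (coact a) (coact b);
  coact1 : coact 1 = 1 \ox 1
}.

(* A [falgType] is finite dimensional and nonzero (1 != 0); the zero algebra has
   no hyperplane. *)
#[short(type="comodAlgType")]
HB.structure Definition ComoduleAlgebra (k : fieldType) (H : hopfAlgType k) :=
  {A of isComoduleAlgebra k H A & Falgebra k A}.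

Section ComoduleAlgebras.
Variables (k : fieldType) (H : hopfAlgType k) (A : comodAlgType H).

(* The action h^* . a = sum h^*(a_1) a_0 of H^* = Hom(H, k) on A. *)
Definition hdot (phi : {linear H -> k^o}) (a : A) : A :=
  tunitr (tmap idfun phi (@coact k H A a)).

(* The data of an object of M^H_A on the vector space M; its axioms are
   [is_doi_hopf].  Morphisms depend on the data only. *)
Record doi_hopf_data (M : lmodType k) := DoiHopfData {
  dh_act : {bilinear M -> A -> M};
  dh_coact : {linear M -> M ⊗ H}
}.

Record is_doi_hopf (M : lmodType k) (d : doi_hopf_data M) : Prop := IsDoiHopf {
  dh_act1 : forall m, dh_act d m 1 = m;
  dh_actM : forall m a b, dh_act d (dh_act d m a) b = dh_act d m (a * b);
  dh_comodule : is_comodule (dh_coact d);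
  dh_compat : forall m a,
    dh_coact d (dh_act d m a) =
      tmap2 (dh_act d) (@amul k H) (dh_coact d m) (@coact k H A a)
}.

Definition is_doi_hopf_morphism (M N : lmodType k)
    (dM : doi_hopf_data M) (dN : doi_hopf_data N) (f : {linear M -> N}) : Prop :=
  (forall m a, f (dh_act dM m a) = dh_act dN (f m) a) /\
  colinear (dh_coact dM) (dh_coact dN) f.

Definition doi_hopf_iso (M N : lmodType k)
    (dM : doi_hopf_data M) (dN : doi_hopf_data N) : Prop :=
  exists (f : {linear M -> N}) (g : {linear N -> M}),
    [/\ is_doi_hopf_morphism dM dN f, is_doi_hopf_morphism dN dM g,
        cancel f g & cancel g f].

Definition regular_dh : doi_hopf_data A := DoiHopfData (@amul k A) (@coact k H A).

Lemma regular_dhP : is_doi_hopf regular_dh.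
Proof.
split=> [m|m a b||m a] /=; rewrite /amul ?mulr1 ?mulrA //.
- exact: coact_comodule.
- exact: coactM.
Qed.

Local Notation dual := 'Hom(A, k^o).

Definition dual_act (f : dual) (a : A) : dual := (f \o amull a)%VF.

Lemma dual_actE f a x : dual_act f a x = f (a * x).
Proof. by rewrite comp_lfunE lfunE. Qed.

Fact dual_act_is_bilinear : bilinear_for *:%R *:%R dual_act.
Proof.
apply: bilinearI => [a c f g|f c a b]; apply/lfunP => x.
- by rewrite add_lfunE scale_lfunE !dual_actE add_lfunE scale_lfunE.
- by rewrite add_lfunE scale_lfunE !dual_actE mulrDl -scalerAl linearP.
Qed.

HB.instance Definition _ :=
  bilinear_isBilinear.Build k dual A dual _ _ dual_act dual_act_is_bilinear.

Definition dual_basis (i : 'I_(\dim {:A})) : dual :=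
  linfun (coord (vbasis {:A}) i : A -> k^o).

(* x |-> sum f(x_0) S(x_1) *)
Definition dual_coact_at (f : dual) (x : A) : H :=
  tunitl (tmap f (@antipode k H) (@coact k H A x)).

(* The coaction f |-> sum f_0 \ox f_1 of A^*, characterised among all elements
   of A^* ⊗ H by sum f_0(x) f_1 = sum f(x_0) S(x_1); see [dual_coactP] and
   [dual_coact_unique]. *)
Definition dual_coact_fun (f : dual) : dual ⊗ H :=
  \sum_i dual_basis i \ox dual_coact_at f (vbasis {:A})`_i.

Fact dual_coact_is_linear : linear dual_coact_fun.
Proof.
move=> c f g; rewrite scaler_sumr -big_split; apply: eq_bigr => i _ /=.
rewrite -linearPr; congr (_ \ox _).
rewrite /dual_coact_at -linearP; congr (tunitl _).
apply: tlift_lin => x h; rewrite /= /tmap_fun /=.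
by rewrite add_lfunE scale_lfunE linearPl.
Qed.

HB.instance Definition _ :=
  GRing.isLinear.Build k dual (tensor dual H) _ dual_coact_fun dual_coact_is_linear.

Definition dual_coact : {linear dual -> dual ⊗ H} := dual_coact_fun.

Definition dual_dh : doi_hopf_data dual := DoiHopfData dual_act dual_coact.

Definition dual_eval (x : A) (f : dual) : k^o := f x.

Fact dual_eval_is_linear x : linear (dual_eval x).
Proof. by move=> c f g; rewrite /dual_eval add_lfunE scale_lfunE. Qed.

HB.instance Definition _ x :=
  GRing.isLinear.Build k dual k^o _ (dual_eval x) (dual_eval_is_linear x).

Lemma dual_coactP f x :
  tunitl (tmap (dual_eval x) idfun (dual_coact f)) = dual_coact_at f x.
Proof.
rewrite /= /dual_coact_fun /dual_coact_at [in RHS](coord_vbasis (memvf x)).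
rewrite !linear_sum; apply: eq_bigr => i _.
by rewrite tmapE tunitlE /= /dual_eval lfunE /= !linearZ.
Qed.

Lemma dual_coact_unique f (t : dual ⊗ H) :
  (forall x, tunitl (tmap (dual_eval x) idfun t) = dual_coact_at f x) ->
  t = dual_coact f.
Proof.
move=> h; rewrite /= /dual_coact_fun.
under eq_bigr do rewrite -h.
elim/tens_ind: t {h} => [|g y t IH].
  by rewrite big1 // => i _; rewrite !linear0 linear0r.
rewrite {1}IH.
under [in RHS]eq_bigr do rewrite !linearD linearDr.
rewrite big_split /=; congr (_ + _).
under eq_bigr => i _ do rewrite tmapE tunitlE linearZr_LR -linearZl_LR /=.
rewrite -linear_sumlz; congr (_ \ox _); apply/lfunP => x.
rewrite sum_lfunE [in LHS](coord_vbasis (memvf x)) linear_sum.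
apply: eq_bigr => i _.
rewrite scale_lfunE lfunE linearZ; exact: mulrC.
Qed.

Definition right_H_Frobenius : Prop := doi_hopf_iso regular_dh dual_dh.

Definition hyperplane (W : {vspace A}) : Prop := (\dim W).+1 = \dim {:A}.

Definition right_ideal (I : {vspace A}) : Prop :=
  forall x a, x \in I -> x * a \in I.

(* Subobjects of A in M^H_A: subspaces carrying a structure of object of M^H_A
   for which the inclusion is a morphism. *)
Definition is_subobject (I : {vspace A}) : Prop :=
  exists d : doi_hopf_data (subvs_of I),
    is_doi_hopf d /\ is_doi_hopf_morphism d regular_dh vsval.

Definition is_Frobenius_in_comodules : Prop :=
  exists (delta : {linear A -> A ⊗ A}) (eps : {linear A -> k^o}),
    [/\ is_coalgebra delta eps,
        colinear (@coact k H A) (tens_coact (@coact k H A) (@coact k H A)) delta,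
        colinear (@coact k H A) (triv_coact H) eps,
        forall a x, delta (a * x) = tmap (amull a) idfun (delta x)
      & forall x a, delta (x * a) = tmap idfun (amulr a) (delta x)].

Definition nondegenerate_form (B : {biscalar A}) : Prop :=
  (forall x, (forall y, B x y = 0) -> x = 0) /\
  (forall y, (forall x, B x y = 0) -> y = 0).

Definition associative_form (B : {biscalar A}) : Prop :=
  forall x y z, B (x * y) z = B x (y * z).

End ComoduleAlgebras.

(* Main.v *)
Require Import Defs.
From HB Require Import structures.
From mathcomp Require Import all_boot all_order all_algebra all_field.
From mathcomp Require Import boolp classical_sets.
Set Implicit Arguments.
Unset Strict Implicit.
Unset Printing Implicit Defensive.
Import GRing.Theory.
Local Open Scope ring_scope.

(** All five conditions speak of one object: a linear form t : A -> k that is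
  H-colinear, t(a_0) a_1 = t(a) 1, and whose kernel contains no nonzero right
  ideal.  From t one recovers the isomorphism A -> A^*, x |-> t(x -) ([frob]),
  the bilinear form B(x, y) = t(xy), the hyperplane ker t, and the counit of the
  Frobenius algebra; conversely t is B(1, -), or a form with kernel the given
  hyperplane, or the counit.

  The identity that makes these passages work is
    t(x_0 y) x_1 = t(x y_0) S(y_1)         ([coinvariant_form_mul]),
  obtained by inserting y_1 S(y_2) = eps(y) 1 and applying colinearity of t to
  x y_0.  It says that [frob t] is a morphism of M^H_A, for any colinear t
  ([frob_morphism]).  Hence the kernel of [frob t] is a subobject of A; it lies
  in ker t, so a hyperplane without nonzero subobjects makes [frob t] injective,
  and bijective since A is finite dimensional.

  For the Frobenius algebra, let f_i in A correspond under [frob t] to the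
  coordinate forms of a basis b_i, that is t(f_i b_j) = delta_ij, and put
  delta(a) = sum a b_i (x) f_i.  Because also delta(a) = sum b_i (x) f_i a, this
  is a bimodule map, coassociative, with counit t.  It is colinear because f_i
  coacts through the antipode of the coefficients of b_i ([coact_dual_family]),
  so the coactions on the two legs cancel.  Conversely, if delta is a bimodule
  map with counit eps, then x = sum eps(x u_i) v_i for delta(1) = sum u_i (x) v_i,
  and [frob eps] is injective.

  H may be infinite dimensional.  To turn the condition h^*.A in ker t for
  h^*(1) = 0 into t(a_0) a_1 in k 1, linear forms on H must separate points from
  subspaces ([separating_functional]), which rests on Zorn's lemma.

  Computations with the coaction are carried out in coordinates: coact a is
  sum b_i (x) c_i(a), and coassociativity and counitality become the matrix
  identities Delta(c_i(a)) = sum_j c_i(b_j) (x) c_j(a) and eps(c_i(a)) = a_i. *)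

(** * Linear forms separating a point from a subspace *)

(** Maximality forces M + k v to be the whole space: for x outside M + k v, the
  subspace M + k x would be larger than M and still avoid v. *)
Lemma maximal_subspace_avoiding (k : fieldType) (V : lmodType k)
    (W : V -> Prop) (v : V) :
  W 0 -> (forall a x y, W x -> W y -> W (a *: x + y)) -> ~ W v ->
  exists M : V -> Prop,
    [/\ forall x, W x -> M x, forall a x y, M x -> M y -> M (a *: x + y),
        ~ M v & forall x, exists a, M (x - a *: v)].
Proof.
move=> W0 Wlin Wv.
pose closed (X : set V) := forall a x y, X x -> X y -> X (a *: x + y).
(* The empty chain has empty union, so containing W is only required of
   nonempty X; the nonemptiness of the maximal element is recovered below. *)
pose above (X : set V) := forall x, X x -> forall w, W w -> X w.
have [F Fsub totF|M [[Mlin WM Mv] Mmax]] := @Zorn_bigcup V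
  (fun X : set V => [/\ closed X, above X & ~ X v]).
  split=> [a x y [X FX Xx] [Y FY Yy]|x [X FX Xx] w Ww|[X FX Xv]].
  - have [XY|YX] := totF X Y FX FY.
    + by exists Y => //; have [Ylin _ _] := Fsub Y FY; apply: Ylin => //; apply: XY.
    + by exists X => //; have [Xlin _ _] := Fsub X FX; apply: Xlin => //; apply: YX.
  - by exists X => //; have [_ WX _] := Fsub X FX; apply: WX Xx w Ww.
  - by have [_ _] := Fsub X FX.
have M0 : M 0.
  apply: contrapT => nM0; apply: (Mmax W); last by split.
  split=> [x Mx|]; last by move=> /(_ 0 W0).
  by case: nM0; apply: WM Mx 0 W0.
exists M; split=> // [|x]; first exact: WM M0.
apply: contrapT => nx.
apply: (Mmax (fun z => exists c, M (z - c *: x))).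
- split=> [z Mz|]; first by exists 0; rewrite scale0r subr0.
  move=> /(_ x) /= xM; apply: nx; exists 0; rewrite scale0r subr0.
  by apply: xM; exists 1; rewrite scale1r subrr.
- split=> [a y z [c Mc] [d Md]|_ _ w Ww|[c Mc]].
  + exists (a * c + d); rewrite scalerDl -scalerA opprD addrACA -scalerBr.
    exact: Mlin.
  + by exists 0; rewrite scale0r subr0; apply: WM M0 w Ww.
  + have c0 : c != 0 by apply: contra_not_neq Mv => c0; rewrite c0 scale0r subr0 in Mc.
    apply: nx; exists c^-1.
    have -> : x - c^-1 *: v = - c^-1 *: (v - c *: x) + 0.
      by rewrite addr0 scalerBr scalerA mulNr mulVf // scaleN1r scaleNr opprK addrC.
    exact: Mlin.
Qed.

(** The form is the coefficient of v in the decomposition of the space as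
  M + k v, for M maximal among the subspaces that contain W and avoid v. *)
Lemma separating_functional (k : fieldType) (V : lmodType k)
    (W : V -> Prop) (v : V) :
  W 0 -> (forall a x y, W x -> W y -> W (a *: x + y)) -> ~ W v ->
  exists phi : {linear V -> k^o}, (forall x, W x -> phi x = 0) /\ phi v = 1.
Proof.
move=> W0 Wlin Wv.
have [M [WM Mlin Mv /choice [c Mc]]] := maximal_subspace_avoiding W0 Wlin Wv.
have cP x a : M (x - a *: v) -> c x = a.
  move=> Ma; apply/eqP; rewrite -subr_eq0; apply: contra_notT Mv => ca0.
  pose y := (x - a *: v) - (x - c x *: v).
  have yE : y = (c x - a) *: v by rewrite /y opprB addrC addrA subrK scalerBl.
  have My : M y by rewrite /y addrC -[- (_ - c x *: v)]scaleN1r; apply: Mlin.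
  suff -> : v = (c x - a)^-1 *: y + 0 by apply: Mlin => //; apply: WM.
  by rewrite addr0 yE scalerA mulVf ?scale1r.
have clin : linear (c : V -> k^o).
  move=> a x y; apply: cP; rewrite scalerDl -scalerA opprD addrACA -scalerBr.
  exact: Mlin.
pose cL := GRing.isLinear.Build k V k^o _ (c : V -> k^o) clin.
pose phi : {linear V -> k^o} := HB.pack (c : V -> k^o) cL.
exists phi; split=> [x Wx|]; apply: cP.
- by rewrite scale0r subr0; apply: WM.
- by rewrite scale1r subrr; apply: WM.
Qed.

(** * Naturality of the tensor operations *)

Section TensorNaturality.
Variable k : fieldType.
Implicit Types U V W X Y : lmodType k.

Lemma tmap_comp U V U' V' U'' V'' (f : {linear U' -> U''}) (g : {linear V' -> V''})
    (f' : {linear U -> U'}) (g' : {linear V -> V'}) z :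
  tmap f g (tmap f' g' z) = tmap (f \o f') (g \o g') z.
Proof.
elim/tens_ind: z => [|u v z IH]; first by rewrite !linear0.
by rewrite !linearD IH !tmapE.
Qed.

Lemma tmap_idK U V W (f : {linear U -> V}) (g : {linear V -> U}) (z : U ⊗ W) :
  cancel f g -> tmap g idfun (tmap f idfun z) = z.
Proof.
move=> fK; elim/tens_ind: z => [|u v z IH]; first by rewrite !linear0.
by rewrite !linearD IH !tmapE /= fK.
Qed.

Lemma tassoc_tmap U V W X (f : {linear U -> X}) (z : U ⊗ V ⊗ W) :
  tmap f idfun (tassoc z) = tassoc (tmap (tmap f idfun) idfun z).
Proof.
elim/tens_ind: z => [|x w z IH]; first by rewrite !linear0.
rewrite !linearD IH; congr (_ + _); elim/tens_ind: x => [|u v x {}IH].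
  by rewrite linear0l !linear0.
by rewrite linearDl !linearD IH tassocE !tmapE tassocE.
Qed.

Lemma tunitr_tmap U X (f : {linear U -> X}) (z : U ⊗ k^o) :
  f (tunitr z) = tunitr (tmap f idfun z).
Proof.
elim/tens_ind: z => [|u c z IH]; first by rewrite !linear0.
by rewrite !linearD IH tmapE !tunitrE linearZ.
Qed.

Lemma tmap2_tmap U V U' V' X Y U1 X1 (F : {bilinear U -> U' -> X})
    (G : {bilinear V -> V' -> Y}) (F1 : {bilinear U1 -> U' -> X1})
    (f : {linear U -> U1}) (h : {linear X -> X1}) z z' :
  (forall u u', h (F u u') = F1 (f u) u') ->
  tmap h idfun (tmap2 F G z z') = tmap2 F1 G (tmap f idfun z) z'.
Proof.
move=> hF; elim/tens_ind: z => [|u v z IH]; first by rewrite !(linear0, linear0l).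
rewrite !(linearD, linearDl) IH tmapE; congr (_ + _).
elim/tens_ind: z' {IH} => [|u' v' z' IH]; first by rewrite !(linear0, linear0r).
rewrite !(linearD, linearDr) IH; congr (_ + _).
transitivity (tmap h idfun (F u u' \ox G v v')).
  by apply: (congr1 (tmap h idfun)); apply: tmap2E.
by rewrite tmapE hF; apply/esym/tmap2E.
Qed.

End TensorNaturality.

Lemma tmap2_sum (k : fieldType) (U V U' V' X Y : lmodType k)
    (F : {bilinear U -> U' -> X}) (G : {bilinear V -> V' -> Y}) (I J : finType)
    (u : I -> U) (v : I -> V) (u' : J -> U') (v' : J -> V') :
  tmap2 F G (\sum_i u i \ox v i) (\sum_j u' j \ox v' j)
    = \sum_i \sum_j F (u i) (u' j) \ox G (v i) (v' j).
Proof.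
rewrite linear_sumlz; apply: eq_bigr => i _.
by rewrite linear_sumr; apply: eq_bigr => j _; apply: tmap2E.
Qed.

Lemma antipode1 (k : fieldType) (H : hopfAlgType k) : antipode (1 : H) = 1.
Proof.
have := antipodel (1 : H); rewrite comul1 tmapE.
move/(etrans (esym (tliftE _ _ _))); rewrite /= /amul mulr1 => ->.
by rewrite counit1 scale1r.
Qed.

(** * Coordinates of the coaction *)

Section FrobeniusComoduleAlgebra.
Variables (k : fieldType) (H : hopfAlgType k) (A : comodAlgType H).

Local Notation n := (\dim {:A}).
Local Notation bs := (vbasis {:A}).
Local Notation "''b_' i" := (vbasis {:A})`_(i : 'I_n)
  (at level 8, i at level 2, format "''b_' i").
Local Notation dual := 'Hom(A, k^o).

Lemma dual_basisE (i : 'I_n) (x : A) : dual_basis i x = coord bs i x.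
Proof. by rewrite lfunE. Qed.

Lemma sum_coord (x : A) : x = \sum_i coord bs i x *: 'b_i.
Proof. exact/coord_vbasis/memvf. Qed.

Lemma coord_basis (i j : 'I_n) : coord bs i 'b_j = (i == j)%:R.
Proof. by rewrite eq_sym; apply: coord_free; apply: basis_free (vbasisP _). Qed.

Definition tens_coord (V : lmodType k) (i : 'I_n) (z : A ⊗ V) : V :=
  tunitl (tmap (dual_basis i) idfun z).

Lemma tens_coord_sum (V : lmodType k) (v : 'I_n -> V) i :
  tens_coord i (\sum_j 'b_j \ox v j) = v i.
Proof.
rewrite /tens_coord !linear_sum (bigD1 i) //= big1 => [|j ji].
  by rewrite tmapE tunitlE /= dual_basisE coord_basis eqxx scale1r addr0.
by rewrite tmapE tunitlE /= dual_basisE coord_basis eq_sym (negPf ji) scale0r.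
Qed.

Lemma tens_coordE (V : lmodType k) (z : A ⊗ V) :
  z = \sum_i 'b_i \ox tens_coord i z.
Proof.
rewrite /tens_coord; elim/tens_ind: z => [|x v z IH].
  by rewrite big1 // => i _; rewrite !linear0 linear0r.
under eq_bigr do rewrite !linearD linearDr tmapE tunitlE /= dual_basisE.
rewrite big_split /= -IH; congr (_ + _).
rewrite {1}(sum_coord x) linear_sumlz; apply: eq_bigr => i _.
by rewrite linearZl_LR linearZr_LR.
Qed.

Definition coact_coef (i : 'I_n) (a : A) : H := tens_coord i (coact a).

Lemma coactE (a : A) : coact a = \sum_i 'b_i \ox coact_coef i a.
Proof. exact: tens_coordE. Qed.

(** Coassociativity of the coaction, read off on the leg b_i of A. *)
Lemma comul_coact_coef i a :
  comul (coact_coef i a) = \sum_j coact_coef i 'b_j \ox coact_coef j a.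
Proof.
have [/(_ a) + _] := @coact_comodule k H A.
rewrite (coactE a) !linear_sum /=.
under eq_bigr do rewrite tmapE /= coactE linear_sumlz linear_sum.
rewrite exchange_big /=.
under eq_bigr do (under eq_bigr do rewrite tassocE; rewrite -linear_sumr).
under [RHS]eq_bigr do rewrite tmapE.
by move=> /(congr1 (tens_coord i)); rewrite !tens_coord_sum.
Qed.

Lemma counit_coact_coef i a : counit (coact_coef i a) = coord bs i a :> k.
Proof.
have [_ /(_ a) /(congr1 (coord bs i)) <-] := @coact_comodule k H A.
rewrite [in RHS]coactE !linear_sum (bigD1 i) //= big1 => [|j ji].
  by rewrite tmapE tunitrE linearZ /= coord_basis eqxx addr0 [RHS]mulr1.
by rewrite tmapE tunitrE linearZ /= coord_basis eq_sym (negPf ji) [LHS]mulr0.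
Qed.

(** The antipode axiom x_1 S(x_2) = eps(x) 1 for x = c_i(a). *)
Lemma coact_coef_antipode i a :
  \sum_j coact_coef i 'b_j * antipode (coact_coef j a) = (coord bs i a)%:A :> H.
Proof.
rewrite -counit_coact_coef -antipoder comul_coact_coef !linear_sum.
apply: eq_bigr => j _; rewrite tmapE; exact/esym/tliftE.
Qed.

Lemma hdotE phi a : hdot phi a = \sum_i (phi (coact_coef i a) : k) *: 'b_i.
Proof.
rewrite /hdot coactE !linear_sum; apply: eq_bigr => i _.
by rewrite tmapE tunitrE.
Qed.

Lemma dual_coact_atE (f : dual) x :
  dual_coact_at f x = \sum_i (f 'b_i : k) *: antipode (coact_coef i x) :> H.
Proof.
rewrite /dual_coact_at coactE !linear_sum; apply: eq_bigr => i _.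
by rewrite tmapE tunitlE.
Qed.

(** With the trivial coaction on k, colinearity of t reads
  t(a_0) a_1 = t(a) 1 in H. *)
Definition coinvariant_form (t : {linear A -> k^o}) : Prop :=
  colinear (@coact k H A) (triv_coact H) t.

Lemma coinvariant_formP (t : {linear A -> k^o}) :
  coinvariant_form t <-> forall a, \sum_i (t 'b_i : k) *: coact_coef i a = (t a : k)%:A.
Proof.
have tE a : tmap t idfun (coact a) = 1 \ox (\sum_i (t 'b_i : k) *: coact_coef i a).
  rewrite coactE linear_sum linear_sumr; apply: eq_bigr => i _.
  by rewrite tmapE linearZr_LR -linearZl_LR /= [_ *: 1]mulr1.
have trE a : triv_coact H (t a) = 1 \ox (t a : k)%:A.
  by rewrite linearZr_LR -linearZl_LR /= [_ *: 1]mulr1.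
split=> h a; last by rewrite tE trE h.
have := h a; rewrite tE trE => /(congr1 tunitl).
by rewrite !tunitlE !scale1r.
Qed.

(** In Sweedler notation, t(x_0 y) x_1 = t(x_0 y_0) x_1 y_1 S(y_2) = t(x y_0) S(y_1):
  the first step inserts y_1 S(y_2) = eps(y_1) 1, the second is colinearity of t at
  the product x y_0. *)
Lemma coinvariant_form_mul (t : {linear A -> k^o}) x y : coinvariant_form t ->
  \sum_i (t ('b_i * y) : k) *: coact_coef i x
    = \sum_i (t (x * 'b_i) : k) *: antipode (coact_coef i y).
Proof.
move=> /coinvariant_formP tP.
have tM a b : (t (a * b) : k)%:A =
    \sum_i \sum_j (t ('b_i * 'b_j) : k) *: (coact_coef i a * coact_coef j b) :> H.
  have tE z : \sum_i (t 'b_i : k) *: coact_coef i z = tunitl (tmap t idfun (coact z)).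
    by rewrite coactE !linear_sum; apply: eq_bigr => i _; rewrite tmapE tunitlE.
  rewrite -tP tE coactM (coactE a) (coactE b) /tmul tmap2_sum !linear_sum.
  apply: eq_bigr => i _; rewrite !linear_sum; apply: eq_bigr => j _.
  by rewrite tmapE tunitlE.
transitivity (\sum_i \sum_j \sum_l (t ('b_j * 'b_l) : k) *:
   (coact_coef j x * (coact_coef l 'b_i * antipode (coact_coef i y)))); last first.
  apply: eq_bigr => i _; rewrite -mulr_algl tM mulr_suml; apply: eq_bigr => j _.
  by rewrite mulr_suml; apply: eq_bigr => l _; rewrite -scalerAl mulrA.
rewrite exchange_big /=; apply: eq_bigr => i _; rewrite exchange_big /=.
rewrite {1}(sum_coord y) mulr_sumr linear_sum scaler_suml; apply: eq_bigr => j _.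
rewrite -scaler_sumr -mulr_sumr coact_coef_antipode.
by rewrite -!scalerAr mulr1 linearZ scalerA; congr (_ *: _); apply: mulrC.
Qed.

(** If t(a_0) a_1 were outside the line k 1, a linear form phi on H would vanish at 1
  but not at t(a_0) a_1, whereas phi(t(a_0) a_1) = t(phi.a).  So t(a_0) a_1 = c 1,
  and the counit gives c = t(a). *)
Lemma coinvariant_form_hdot (t : {linear A -> k^o}) :
  (forall (phi : {linear H -> k^o}) a, phi 1 = 0 -> t (hdot phi a) = 0) ->
  coinvariant_form t.
Proof.
move=> tker; apply/coinvariant_formP => a.
set h := \sum_i _.
have [c hc] : exists c, h = c *: 1.
  apply: contrapT => hN.
  have [||phi [phi1 phih]] :=
    separating_functional (W := fun h => exists c, h = c *: 1) _ _ hN.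
  - by exists 0; rewrite scale0r.
  - by move=> b x y [c ->] [d ->]; exists (b * c + d); rewrite scalerDl scalerA.
  have tphi : t (hdot phi a) = phi h.
    rewrite hdotE !linear_sum; apply: eq_bigr => i _; rewrite !linearZ; exact: mulrC.
  have := tker phi a (phi1 1 (ex_intro _ 1 (esym (scale1r 1)))).
  by rewrite tphi phih; apply/eqP/oner_neq0.
rewrite hc; congr (_ *: _).
have <- : (counit h : k) = c by rewrite hc linearZ counit1; apply: mulr1.
rewrite /h [in RHS](sum_coord a) !linear_sum.
apply: eq_bigr => i _.
by rewrite !linearZ counit_coact_coef; apply: mulrC.
Qed.

(** * The morphism from A to its dual defined by a linear form *)

Definition frob (t : {linear A -> k^o}) : {linear A -> dual} := dh_act (dual_dh A) (linfun t).

Lemma frobE t x y : frob t x y = t (x * y).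
Proof. by rewrite /= dual_actE lfunE. Qed.

(** Colinearity is [coinvariant_form_mul]: at y, the coaction of A on x contributes
  t(x_0 y) x_1 and the coaction of A^* contributes t(x y_0) S(y_1). *)
Lemma frob_morphism t : coinvariant_form t ->
  is_doi_hopf_morphism (regular_dh A) (dual_dh A) (frob t).
Proof.
move=> tP; split=> [x a|x].
  apply/lfunP => y; rewrite frobE; apply: etrans (esym (dual_actE _ _ _)).
  by rewrite frobE /= /amul mulrA.
apply/esym/dual_coact_unique => y; rewrite tmap_comp dual_coact_atE.
under eq_bigr do rewrite frobE.
rewrite -(coinvariant_form_mul _ _ tP) [dh_coact _ _]coactE !linear_sum.
by apply: eq_bigr => i _; rewrite tmapE tunitlE /= /dual_eval frobE.
Qed.

Lemma frob_bijective t : injective (frob t) ->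
  exists g : {linear dual -> A}, cancel (frob t) g /\ cancel g (frob t).
Proof.
move=> inj; pose F := linfun (frob t).
have kerF : lker F == 0%VS by apply/lker0P => x y; rewrite !lfunE; apply: inj.
have imF : limg F = fullv.
  apply/eqP; rewrite eqEdim subvf (limg_dim_eq _) ?(eqP kerF) ?capv0 //.
  by rewrite !dimvf /dim /= muln1.
exists (F^-1)%VF; split=> [x|f].
- by rewrite -[frob t x]lfunE; apply: lker0_lfunK.
- by rewrite -[frob t _]lfunE; apply: limg_lfunVK; rewrite imF memvf.
Qed.

Lemma frob_iso t : coinvariant_form t -> injective (frob t) -> right_H_Frobenius A.
Proof.
move=> tP /frob_bijective [g [fK gK]]; have [fact fcoact] := frob_morphism tP.
exists (frob t), g; split=> //; split=> [f a|f].
- by apply: (can_inj fK); rewrite fact !gK.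
- by rewrite -[f in RHS]gK fcoact tmap_idK.
Qed.

(** * Kernels of morphisms in M^H_A *)

Section Subobject.
Variable I : {vspace A}.

Definition sub_act (u : subvs_of I) (a : A) : subvs_of I := vsproj I (vsval u * a).

Fact sub_act_is_bilinear : bilinear_for *:%R *:%R sub_act.
Proof.
apply: bilinearI => [a c u v|u c a b]; rewrite /sub_act.
- by rewrite linearP mulrDl -scalerAl linearP.
- by rewrite mulrDr -scalerAr linearP.
Qed.

HB.instance Definition _ :=
  bilinear_isBilinear.Build k _ A _ _ _ sub_act sub_act_is_bilinear.

Definition sub_dh : doi_hopf_data A (subvs_of I) :=
  DoiHopfData sub_act (tmap (vsproj I) idfun \o @coact k H A \o vsval).

(** The second hypothesis encodes stability under the coaction: projecting the A-leg
  of the coaction of x to I loses nothing.  All axioms are inherited from A since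
  the inclusion of I stays injective after tensoring, being split. *)
Lemma stable_right_ideal_subobject : right_ideal I ->
  (forall x, x \in I -> tmap vsval idfun (tmap (vsproj I) idfun (coact x)) = coact x) ->
  is_subobject I.
Proof.
move=> idI coI.
have actJ u a : vsval (sub_act u a) = vsval u * a.
  by rewrite vsprojK //; apply: idI; apply: subvsP.
have coactJ u : tmap vsval idfun (dh_coact sub_dh u) = coact (vsval u).
  by apply: coI; apply: subvsP.
have vsval_inj : injective (@vsval _ _ I) := can_inj vsvalK.
have tval_inj (W : lmodType k) : injective (tmap (@vsval _ _ I) (@idfun W)).
  by apply: (can_inj (g := tmap (vsproj I) idfun)) => z; apply/tmap_idK/vsvalK.
have [coA coU] := @coact_comodule k H A.
have comodJ (r : {linear subvs_of I -> subvs_of I ⊗ H}) :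
    (forall u, tmap vsval idfun (r u) = coact (vsval u)) -> is_comodule r.
  move=> rJ; split=> u.
  - apply: tval_inj; rewrite tassoc_tmap !tmap_comp.
    transitivity (tassoc (tmap (@coact k H A) idfun (coact (vsval u)))).
      by rewrite -rJ tmap_comp; congr (tassoc _); apply: eq_tmap.
    by rewrite coA -rJ tmap_comp.
  - apply: vsval_inj; rewrite tunitr_tmap tmap_comp.
    transitivity (tunitr (tmap idfun (@counit k H) (coact (vsval u)))); last exact: coU.
    by rewrite -rJ tmap_comp.
exists sub_dh; split; last by split=> [u a|u]; rewrite ?coactJ //; apply: actJ.
split=> [u|u a b||u a].
- by apply: vsval_inj; rewrite actJ mulr1.
- by apply: vsval_inj; rewrite !actJ mulrA.
- exact: comodJ.
- apply: tval_inj; rewrite coactJ actJ coactM.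
  have hact v b : vsval (dh_act sub_dh v b) = amul (vsval v) b by apply: actJ.
  by rewrite (tmap2_tmap _ _ _ hact) coactJ.
Qed.

End Subobject.

(** Stability under the coaction: a map p vanishing on ker f factors as p = q f, so
  (p (x) id)(coact x) = (q (x) id)(coact (f x)) = 0 for x in ker f.  This is applied
  to p = id minus the projection to ker f, with q = p f^-1. *)
Lemma kernel_subobject (N : vectType k) (dN : doi_hopf_data A N) (f : {linear A -> N}) :
  is_doi_hopf_morphism (regular_dh A) dN f -> is_subobject (lker (linfun f)).
Proof.
move=> [fact fcoact]; pose F : 'Hom(A, N) := linfun f; rewrite -/F.
have kerE x : (x \in lker F) = (f x == 0) by rewrite memv_ker lfunE.
apply: stable_right_ideal_subobject => [x a|x] /[!kerE] /eqP fx.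
  by apply/eqP; apply: etrans (fact x a) _; rewrite fx linear0l.
pose p : 'End(A) := (\1 - linfun (vsval \o vsproj (lker F)))%VF.
have pE y : p y = y - vsval (vsproj (lker F) y).
  by rewrite add_lfunE opp_lfunE id_lfunE lfunE.
have pker y : f y = 0 -> p y = 0.
  by move=> fy; rewrite pE vsprojK ?subrr // kerE fy.
have pf y : p ((F^-1)%VF (f y)) = p y.
  apply: subr0_eq; rewrite -linearB; apply: pker; rewrite linearB -!(lfunE f) /=.
  by apply/eqP; rewrite subr_eq0; apply/eqP/limg_lfunVK/memv_img/memvf.
have pB z : tmap p (@idfun H) z
    = z - tmap vsval idfun (tmap (vsproj (lker F)) idfun z).
  rewrite tmap_comp; elim/tens_ind: z => [|y h z IH]; first by rewrite !linear0 addr0.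
  by rewrite !linearD IH !tmapE /= pE linearBl addrACA.
apply/esym/eqP; rewrite -subr_eq0 -pB.
rewrite -(eq_tmap (f := p \o (F^-1)%VF \o f) (g := idfun \o idfun) pf (frefl _)).
by rewrite -(tmap_comp (p \o (F^-1)%VF) idfun f) -fcoact fx !linear0.
Qed.

(** * The Frobenius algebra of a nondegenerate colinear form *)

Lemma tmap_amull (a x y : A) : tmap (amull a) idfun (x \ox y) = (a * x) \ox y.
Proof.
have ax : amull a x = a * x by rewrite lfunE.
by rewrite -ax tmapE.
Qed.

Lemma tmap_amulr (a x y : A) : tmap idfun (amulr a) (x \ox y) = x \ox (y * a).
Proof.
have ya : amulr a y = y * a by rewrite lfunE.
by rewrite -ya tmapE.
Qed.

(** The f_i correspond under [frob t] to the coordinate forms.  The second property,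
  dual to the expansion a = sum t(f_i a) b_i, holds because both sides have the same
  image under [frob t]. *)
Lemma frob_dual_family t : injective (frob t) ->
  exists f : 'I_n -> A, (forall i x, t (f i * x) = coord bs i x) /\
    (forall a, a = \sum_i (t (a * 'b_i) : k) *: f i).
Proof.
move=> inj; have [g [_ gK]] := frob_bijective inj.
exists (fun i => g (dual_basis i)).
have tg i x : t (g (dual_basis i) * x) = coord bs i x.
  by rewrite -frobE gK dual_basisE.
split=> // a; apply: inj; apply/lfunP => y.
rewrite !frobE mulr_suml linear_sum {1}(sum_coord y) mulr_sumr linear_sum.
apply: eq_bigr => i _; rewrite -scalerAl -scalerAr !linearZ tg; exact: mulrC.
Qed.

Definition casimir_comul (f : 'I_n -> A) (a : A) : A ⊗ A :=
  \sum_i (a * 'b_i) \ox f i.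

Fact casimir_comul_is_linear f : linear (casimir_comul f).
Proof.
move=> c a b; rewrite scaler_sumr -big_split; apply: eq_bigr => i _ /=.
by rewrite mulrDl -scalerAl linearPl.
Qed.

HB.instance Definition _ f :=
  GRing.isLinear.Build k A (tensor A A) _ (casimir_comul f) (casimir_comul_is_linear f).

Section Casimir.
Variables (t : {linear A -> k^o}) (f : 'I_n -> A).
Hypothesis tf : forall i x, t (f i * x) = coord bs i x.
Hypothesis ft : forall a, a = \sum_i (t (a * 'b_i) : k) *: f i.

(** The Casimir element sum b_i (x) f_i is central for the A-bimodule structure: the
  same coefficients t(f_j a b_i) expand a b_i in the b_j and f_j a in the f_i. *)
Lemma casimir_comulE a : casimir_comul f a = \sum_i 'b_i \ox (f i * a).
Proof.
rewrite /casimir_comul.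
under eq_bigr => i _ do rewrite (sum_coord (a * 'b_i)) linear_sumlz.
rewrite exchange_big /=; apply: eq_bigr => j _.
rewrite [in RHS](ft (f j * a)) linear_sumr; apply: eq_bigr => i _.
by rewrite -tf mulrA linearZl_LR linearZr_LR.
Qed.

(** With delta(c) = sum c b_i (x) f_i = sum b_j (x) f_j c, both iterated
  comultiplications of c equal sum b_j (x) f_j c b_i (x) f_i, and the two counit
  axioms are the expansions of c in the f_i and in the b_i. *)
Lemma casimir_coalgebra : is_coalgebra (casimir_comul f) t.
Proof.
split=> c.
- rewrite [in RHS]/= casimir_comulE linear_sum /= {1}/casimir_comul !linear_sum /=.
  under eq_bigr do rewrite tmapE /= casimir_comulE linear_sumlz linear_sum.
  rewrite exchange_big /=; apply: eq_bigr => j _.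
  rewrite tmapE /= linear_sumr; apply: eq_bigr => i _.
  by rewrite tassocE mulrA.
- rewrite [in RHS](ft c) !linear_sum; apply: eq_bigr => i _.
  by rewrite tmapE tunitlE.
- transitivity (tunitr (tmap idfun t (\sum_i 'b_i \ox (f i * c)))).
    by rewrite -casimir_comulE.
  rewrite [in RHS](sum_coord c) !linear_sum.
  apply: eq_bigr => i _; rewrite tmapE tunitrE -tf //.
Qed.

Hypothesis tP : coinvariant_form t.

(** The bases f and b being dual under t, f coacts contragrediently to b.  Expanding
  the A-leg in the f_j, the coefficient of f_j is t((f_i)_0 b_j) (f_i)_1, which
  [coinvariant_form_mul] turns into t(f_i (b_j)_0) S((b_j)_1) = S(c_i(b_j)). *)
Lemma coact_dual_family i :
  coact (f i) = \sum_j f j \ox antipode (coact_coef i 'b_j).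
Proof.
rewrite coactE.
under eq_bigr => m _ do rewrite (ft 'b_m) linear_sumlz.
rewrite exchange_big /=; apply: eq_bigr => j _.
under eq_bigr do rewrite linearZl_LR -linearZr_LR.
rewrite -linear_sumr coinvariant_form_mul // (bigD1 i) //= big1 => [|m mi].
  by rewrite tf coord_basis eqxx scale1r addr0.
by rewrite tf coord_basis eq_sym (negPf mi) scale0r.
Qed.

(** The coaction of delta(a) = sum a b_i (x) f_i is
    sum b_p b_l (x) f_j (x) c_p(a) c_l(b_i) S(c_i(b_j)),
  where summing over i leaves delta_lj by the antipode axiom, so that only c_p(a)
  remains on the leg H. *)
Lemma casimir_colinear :
  colinear (@coact k H A) (tens_coact (@coact k H A) (@coact k H A)) (casimir_comul f).
Proof.
move=> a.
transitivity (\sum_i tmap2 (@tens k A A) (@amul k H)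
  (tmul (coact a) (coact 'b_i)) (coact (f i))).
  by rewrite linear_sum; apply: eq_bigr => i _; rewrite -coactM; apply: tliftE.
transitivity (\sum_i \sum_p \sum_l \sum_j
  'b_p * 'b_l \ox f j \ox
    (coact_coef p a * (coact_coef l 'b_i * antipode (coact_coef i 'b_j)))).
  apply: eq_bigr => i _; rewrite (coactE a) (coactE 'b_i) /tmul tmap2_sum.
  rewrite coact_dual_family linear_sumlz; apply: eq_bigr => p _.
  apply: etrans (tmap2_sum _ _ _ _ _ _) _.
  apply: eq_bigr => l _; apply: eq_bigr => j _.
  by rewrite /= /amul mulrA.
rewrite exchange_big coactE linear_sum; apply: eq_bigr => p _ /=.
rewrite tmapE /= /casimir_comul linear_sumlz exchange_big; apply: eq_bigr => l _ /=.
rewrite exchange_big /=.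
under eq_bigr do rewrite -linear_sumr -mulr_sumr coact_coef_antipode.
rewrite (bigD1 l) //= big1 => [|j jl].
  by rewrite coord_basis eqxx scale1r mulr1 addr0.
by rewrite coord_basis eq_sym (negPf jl) scale0r mulr0 linear0r.
Qed.

Lemma casimir_Frobenius : is_Frobenius_in_comodules A.
Proof.
exists (casimir_comul f), t; split=> //.
- exact: casimir_coalgebra.
- exact: casimir_colinear.
- move=> a x; rewrite /= /casimir_comul linear_sum; apply: eq_bigr => i _.
  by rewrite -mulrA; apply/esym/tmap_amull.
- move=> x a; rewrite /= !casimir_comulE linear_sum; apply: eq_bigr => i _.
  by rewrite mulrA; apply/esym/tmap_amulr.
Qed.

End Casimir.

(** The kernel of [frob t] is a subobject; it lies in ker t because t(x) = t(x 1). *)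
Lemma frob_injective t : coinvariant_form t ->
  (forall I : {vspace A}, is_subobject I -> (I <= lker (linfun t))%VS -> I = 0%VS) ->
  injective (frob t).
Proof.
move=> tP noI.
have /eqP/lker0P inj : lker (linfun (frob t)) = 0%VS.
  apply: noI; first exact: kernel_subobject (frob_morphism tP).
  apply/subvP => x; rewrite !memv_ker !lfunE => /eqP fx0.
  by rewrite -[x]mulr1 -frobE fx0 zero_lfunE.
by move=> x y xy; apply: inj; rewrite !lfunE.
Qed.

(** Writing delta(1) = sum u_i (x) v_i, one has x = sum eps(x u_i) v_i, which vanishes
  as soon as eps(x y) = 0 for all y. *)
Lemma counit_frob_injective (delta : {linear A -> A ⊗ A}) (eps : {linear A -> k^o}) :
  (forall c, tunitl (tmap eps idfun (delta c)) = c) ->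
  (forall a x, delta (a * x) = tmap (amull a) idfun (delta x)) ->
  injective (frob eps).
Proof.
move=> epsl deltal; apply: raddf_inj => x fx.
rewrite -(epsl x) -[x]mulr1 deltal.
elim/tens_ind: (delta 1) => [|a b z IH]; first by rewrite !linear0.
rewrite !linearD IH addr0 tmap_amull tmapE tunitlE.
by rewrite -frobE fx zero_lfunE scale0r.
Qed.

(** * Hyperplanes and bilinear forms *)

Lemma hyperplane_lker (t : dual) x : t x != 0 -> hyperplane (lker t).
Proof.
move=> tx; rewrite /hyperplane -(limg_ker_dim t fullv) capfv.
suff -> : \dim (limg t) = 1%N by rewrite addn1.
apply/eqP; rewrite eqn_leq; apply/andP; split.
  by apply: leq_trans (dimvS (subvf _)) _; rewrite dimvf.
rewrite lt0n dimv_eq0; apply: contraNneq tx => t0.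
by rewrite -memv0 -t0 memv_img // memvf.
Qed.

Lemma hyperplane_functional (W : {vspace A}) : hyperplane W ->
  exists t : {linear A -> k^o}, lker (linfun t) = W.
Proof.
move=> hW.
have [v vW] : exists v, v \notin W.
  apply: contrapT => nv; move: hW; rewrite /hyperplane.
  have -> : W = fullv.
    by apply/vspaceP => x; rewrite memvf; apply: contrapT => /negP xW; apply: nv; exists x.
  by move/eqP; rewrite (gtn_eqF (ltnSn _)).
have [|a x y xW yW|t [tW tv]] := separating_functional (W := fun x => x \in W) _ _ (negP vW).
- exact: mem0v.
- by rewrite memvD ?memvZ.
exists t; apply/esym/eqP; rewrite eqEdim; apply/andP; split.
  by apply/subvP => x xW; rewrite memv_ker lfunE /= tW.
rewrite -ltnS; have -> : (\dim W).+1 = \dim {:A} by [].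
have <- // : hyperplane (lker (linfun t)).
by apply: (@hyperplane_lker _ v); rewrite lfunE /= tv; apply/oner_neq0.
Qed.

Definition eval_form (f : {linear A -> dual}) (x y : A) : k := f x y.

Fact eval_form_is_bilinear f : bilinear_for *%R *%R (eval_form f).
Proof.
split=> [y a x x'|x a y y']; rewrite /eval_form linearP //.
by rewrite add_lfunE scale_lfunE.
Qed.

HB.instance Definition _ f :=
  bilinear_isBilinear.Build k A A k _ _ (eval_form f) (eval_form_is_bilinear f).

(** Associativity of B is right A-linearity of the isomorphism f : A -> A^*, and the
  compatibility with H^* is its colinearity f(a)_0 (x) f(a)_1 = f(a_0) (x) a_1,
  evaluated at y in the A^*-leg and at phi in the H-leg. *)
Lemma Frobenius_form : right_H_Frobenius A ->
  exists B : {biscalar A},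
    [/\ nondegenerate_form B, associative_form B
      & forall (x y : A) (phi : {linear H -> k^o}),
          B (hdot phi x) y = B x (hdot (phi \o @antipode k H) y)].
Proof.
move=> [f [g [[fact fcoact] _ fK gK]]].
exists (eval_form f); split=> [|x y z|x y phi].
- split=> [x Bx|y By].
    apply: (can_inj fK); rewrite linear0; apply/lfunP => y; rewrite zero_lfunE; exact: Bx.
  rewrite (sum_coord y) big1 // => i _.
  by rewrite -(dual_basisE i y) -(gK (dual_basis i)) [f _ y]By scale0r.
- by apply: etrans (congr1 (fun h : 'Hom(A, k^o) => h z) (fact x y)) _; apply: dual_actE.
- have atE : dual_coact_at (f x) y = \sum_i (f 'b_i y : k) *: coact_coef i x.
    rewrite -dual_coactP [dual_coact A (f x)]fcoact [dh_coact _ x]coactE !linear_sum.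
    by apply: eq_bigr => i _; rewrite !tmapE tunitlE.
  transitivity (phi (dual_coact_at (f x) y)).
    rewrite atE hdotE /= /eval_form !linear_sum sum_lfunE; apply: eq_bigr => i _.
    by rewrite !linearZ scale_lfunE; apply: mulrC.
  rewrite dual_coact_atE hdotE /= /eval_form !linear_sum; apply: eq_bigr => i _.
  by rewrite !linearZ; apply: mulrC.
Qed.

(** The hyperplane is the kernel of t = B(1, -).  A right ideal I in ker t vanishes
  since B(x, y) = t(xy) = 0 for x in I, and t(phi.a) = B(a, (phi S).1) with
  (phi S).1 = phi(1) 1. *)
Lemma form_hyperplane (B : {biscalar A}) :
  nondegenerate_form B -> associative_form B ->
  (forall (x y : A) (phi : {linear H -> k^o}),
     B (hdot phi x) y = B x (hdot (phi \o @antipode k H) y)) ->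
  exists W : {vspace A},
    [/\ hyperplane W,
        forall I : {vspace A}, right_ideal I -> (I <= W)%VS -> I = 0%VS
      & forall (phi : {linear H -> k^o}) (a : A), phi 1 = 0 -> hdot phi a \in W].
Proof.
move=> [Bl _] Bassoc Bdot.
have Blin : linear (B 1 : A -> k^o) by move=> c x y; rewrite linearP.
pose tL := GRing.isLinear.Build k A k^o _ (B 1 : A -> k^o) Blin.
pose t : {linear A -> k^o} := HB.pack (B 1 : A -> k^o) tL.
have tE x : t x = B x 1 by rewrite -[x in RHS]mul1r Bassoc mulr1.
exists (lker (linfun t)); split=> [|I idI IW|phi a phi1].
- have [x tx] : exists x, t x != 0.
    apply: contrapT => t0; have /eqP := oner_neq0 A; apply; apply: Bl => y.
    by apply: contrapT => /eqP By; apply: t0; exists y.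
  by apply: (@hyperplane_lker _ x); rewrite lfunE.
- apply/eqP; rewrite -subv0; apply/subvP => x xI; rewrite memv0; apply/eqP/Bl => y.
  have /(subvP IW) := idI x y xI; rewrite memv_ker lfunE /= => /eqP.
  by rewrite -Bassoc mul1r.
- rewrite memv_ker lfunE; apply/eqP; apply: etrans (tE _) _; rewrite Bdot.
  have -> : hdot (phi \o @antipode k H) (1 : A) = 0.
    by rewrite /hdot coact1 tmapE tunitrE /= antipode1 phi1 scale0r.
  exact: linear0r.
Qed.

End FrobeniusComoduleAlgebra.

(** * The equivalence *)

Unset Implicit Arguments.

Theorem theorem2p4 (k : fieldType) (H : hopfAlgType k) (A : comodAlgType H) :
  [<->
   right_H_Frobenius A;
   exists B : {biscalar A},
     [/\ nondegenerate_form B, associative_form B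
       & forall (a b : A) (phi : {linear H -> k^o}),
           B (hdot phi a) b = B a (hdot (phi \o @antipode k H) b)];
   exists W : {vspace A},
     [/\ hyperplane W,
         forall I : {vspace A}, right_ideal I -> (I <= W)%VS -> I = 0%VS
       & forall (phi : {linear H -> k^o}) (a : A), phi 1 = 0 -> hdot phi a \in W];
   exists W : {vspace A},
     [/\ hyperplane W,
         forall I : {vspace A}, is_subobject I -> (I <= W)%VS -> I = 0%VS
       & forall (phi : {linear H -> k^o}) (a : A), phi 1 = 0 -> hdot phi a \in W];
   is_Frobenius_in_comodules A].
Proof.
tfae.
- exact: Frobenius_form.
- by move=> [B [Bnd Bassoc Bdot]]; apply: form_hyperplane Bnd Bassoc Bdot.
- (* A subobject is a right ideal because the inclusion is A-linear. *)
  move=> [W [hW noI Wdot]]; exists W; split=> // I [d [_ [vact _]]].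
  apply: noI => x a xI.
  have := vact (vsproj I x) a; rewrite /= /amul vsprojK // => <-; exact: subvsP.
- move=> [W [hW noI Wdot]]; have [t tW] := hyperplane_functional hW.
  have tP : coinvariant_form t.
    apply: coinvariant_form_hdot => phi a /(Wdot phi a).
    by rewrite -tW memv_ker lfunE => /eqP.
  have inj : injective (frob t) by apply: frob_injective => //; rewrite tW.
  have [f [tf ft]] := frob_dual_family inj.
  exact: casimir_Frobenius tf ft tP.
- move=> [delta [eps [[_ epsl _] _ epsP deltal _]]].
  apply: (frob_iso epsP); exact: counit_frob_injective epsl deltal.
Qed.
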